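(* Any (possibly randomized) one-pass streaming algorithm that solves \textsc{topo-sort} on $n$-vertex digraphs with error probability at most $1/3$ requires $\Omega(n^2)$ bits of space.
   Context: The input is a digraph $G=(V,E)$ on $n$ vertices presented as a stream of its edges in an arbitrary (adversarial) order. An ordering of $G$ is a bijection $\sigma\colon V\to[n]$; it is a topological ordering if there is no edge $(v,u)\in E$ with $\sigma(u)<\sigma(v)$. \textsc{topo-sort}: under the promise that $G$ is acyclic, output a topological ordering of its vertices. Randomized algorithms must be correct with probability at least $2/3$. *)

(* Defs.v *)
From HB Require Import structures.
From mathcomp Require Import all_boot all_order all_algebra all_fingroup.
From mathcomp Require Import all_classical all_reals all_analysis.

Set Implicit Arguments.
Unset Strict Implicit.
Unset Printing Implicit Defensive.

Import Order.TTheory GRing.Theory Num.Theory.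

Local Open Scope classical_set_scope.
Local Open Scope ring_scope.

Definition edge (n : nat) : finType := ('I_n * 'I_n)%type.

(* A digraph on n vertices is given by its edge set on the vertex set 'I_n. *)
Definition digraph (n : nat) := {set edge n}.

Definition acyclic (n : nat) (E : digraph n) : Prop :=
  forall c : seq 'I_n, c != [::] -> ~~ path.cycle (fun u v => (u, v) \in E) c.

Definition topological_ordering (n : nat) (E : digraph n) (sigma : 'S_n)
  : Prop :=
  ~ exists v u : 'I_n, (v, u) \in E /\ (sigma u < sigma v)%N.

Definition stream_of (n : nat) (E : digraph n) (l : seq (edge n)) : Prop :=
  perm_eq l (enum E).

(* One-pass streaming algorithms with s bits of memory and random source Omega.
   An outcome of Omega contains all the coins the algorithm ever tosses; reading
   them is not charged to the space.  The nat argument of [sa_update] is the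
   number of edges read so far: it allows fresh coins to be used at every step
   (as well as coins shared by all steps).  There is no uniformity or
   computability requirement, and only the contents of the memory between two
   edges is charged.  The output is produced once the whole stream is read. *)
Record streaming_algorithm (n s : nat) (d : measure_display)
    (Omega : measurableType d) := StreamingAlgorithm {
  sa_init : Omega -> s.-tuple bool;
  sa_update : Omega -> nat -> s.-tuple bool -> edge n -> s.-tuple bool;
  sa_output : Omega -> s.-tuple bool -> 'S_n;
  sa_init_measurable : forall y,
    measurable [set w | sa_init w = y];
  sa_update_measurable : forall t x e y,
    measurable [set w | sa_update w t x e = y];
  sa_output_measurable : forall x sigma,
    measurable [set w | sa_output w x = sigma]
}.

Fixpoint sa_process (n s : nat) (d : measure_display) (Omega : measurableType d)
    (A : streaming_algorithm n s Omega) (w : Omega) (t : nat)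
    (x : s.-tuple bool) (l : seq (edge n)) : s.-tuple bool :=
  if l is e :: l' then sa_process A w t.+1 (sa_update A w t x e) l' else x.

Definition sa_run (n s : nat) (d : measure_display) (Omega : measurableType d)
    (A : streaming_algorithm n s Omega) (w : Omega) (l : seq (edge n)) : 'S_n :=
  sa_output A w (sa_process A w 0 (sa_init A w) l).

Definition solves_topo_sort (R : realType) (n s : nat) (d : measure_display)
    (Omega : measurableType d) (P : probability Omega R)
    (A : streaming_algorithm n s Omega) (eps : R) : Prop :=
  forall (E : digraph n) (l : seq (edge n)),
    acyclic E -> stream_of E l ->
    (P [set w | ~ topological_ordering E (sa_run A w l)] <= eps%:E)%E.

(* Main.v *)
Require Import Defs.
From mathcomp Require Import all_boot all_order all_algebra all_fingroup.
From mathcomp Require Import all_classical all_reals all_analysis.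
From mathcomp Require Import measurable_realfun zify ring lra.

Set Implicit Arguments.
Unset Strict Implicit.

Import Order.TTheory GRing.Theory Num.Theory.

Local Open Scope classical_set_scope.
Local Open Scope ring_scope.

(* Reduction from the one-way communication problem INDEX.  Alice encodes a
   bit matrix [x] as the bipartite graph with edges [a_i^p -> b_j^p], where
   [p = x (i, j)]; to read the bit [(i, j)], Bob appends [b_j^p -> a_i^(~~ p)]
   for both [p].  The result is acyclic, and its paths force [a_i^0] before
   [b_j^0] if the bit is 0 and after it if the bit is 1.  Averaging over inputs
   and positions fixes the coins so that at most a third of the bits are decoded
   wrongly, and [2 ^ s] memory states cannot support this unless [s] is linear
   in the number of bits. *)

(** * Acyclicity from a rank, and numerical estimates *)

Lemma acyclic_of_rank (n : nat) (E : digraph n) (h : 'I_n -> nat) :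
  (forall u v, (u, v) \in E -> (h u < h v)%N) -> acyclic E.
Proof.
move=> hE [//|u p] _; apply/negP => /= cyc.
have : path (relpre h ltn) u (rcons p u).
  by apply: sub_path cyc => a b; exact: hE.
have tr : transitive (relpre h ltn) by move=> a b c; exact: ltn_trans.
move=> /(order_path_min tr) /allP /(_ u).
by rewrite mem_rcons inE eqxx /= ltnn => /(_ isT).
Qed.

(** At integers [y = N - d] and [y0 = N - k], this is [2 ^ y >= 2 ^ y0 * (1 + (y - y0) / 2)],
    cleared of subtraction: convexity puts [2 ^ y] above its secant through [y0 - 1] and [y0]. *)
Lemma exp2_tangent (N k d : nat) : (k < N)%N -> (d <= N)%N ->
  (2 ^ (N - k) * (k + 2) <= 2 * 2 ^ (N - d) + 2 ^ (N - k) * d)%N.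
Proof.
move=> kN dN; case: (leqP d k) => dk.
  have -> : (N - d = (N - k) + (k - d))%N by lia.
  rewrite expnD; have := ltn_expl (k - d) (isT : (1 < 2)%N).
  by set a := (2 ^ (N - k))%N; set b := (2 ^ (k - d))%N; nia.
case: (eqVneq d k.+1) => [->|ne].
  have -> : (N - k = (N - k.+1).+1)%N by lia.
  by rewrite expnS; lia.
have kd : (k + 2 <= d)%N by lia.
by apply: leq_trans (leq_addl _ _); rewrite leq_mul2l kd orbT.
Qed.

(* Since [32 / 27 >= 7 / 6] and [(7 / 6) ^ 5 >= 2]; going through [7 / 6] keeps
   the unary numerals small. *)
Lemma exponent_bound (k s : nat) :
  (32 ^ k <= 2 ^ s * 27 ^ k)%N -> (k <= 5 * s)%N.
Proof.
move=> bnd.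
have pos a : (0 < a.+1 ^ k)%N by rewrite expn_gt0.
have le76 : (7 ^ k <= 2 ^ s * 6 ^ k)%N.
  rewrite -(leq_pmul2r (pos 26)) -expnMn.
  apply: (@leq_trans (32 ^ k * 6 ^ k)).
    rewrite -expnMn; case: (k) => [|k'] ; [by []|].
    rewrite leq_exp2r; by [].
  by rewrite mulnAC leq_mul2r bnd orbT.
have pos5 : (0 < (6 ^ 5) ^ k)%N by rewrite -expnM expn_gt0.
rewrite -(@leq_exp2l 2); last by [].
rewrite -(leq_pmul2r pos5) -expnMn.
apply: (@leq_trans ((7 ^ 5) ^ k)).
  case: (k) => [|k']; first by [].
  rewrite leq_exp2r; first by vm_compute.
  by [].
rewrite -!expnM (mulnC 5 k) (mulnC 5 s) !expnM -expnMn.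
rewrite leq_exp2r; by [].
Qed.

(** * Deterministic lower bound for INDEX with average error *)

Section DeterministicIndex.
Local Open Scope nat_scope.

(** The sum factors over coordinates, each contributing 2 (agree) plus 1 (differ). *)
Lemma sum_exp2_agreement (K : finType) (z : K -> bool) :
  \sum_(x : {ffun K -> bool}) 2 ^ (\sum_i (z i == x i)) = 3 ^ #|K|.
Proof.
transitivity (\prod_(i : K) \sum_(b : bool) 2 ^ (z i == b)).
  rewrite bigA_distr_bigA /=; apply: eq_bigr => x _.
  by rewrite expn_sum.
rewrite (eq_bigr (fun=> 3)) ?prod_nat_const // => i _.
by rewrite big_bool; case: (z i).
Qed.

(* The sum of [2 ^ agreement] over all inputs is at most [#|Y| * 3 ^ (3k)],
   as each of the [#|Y|] messages is decoded to one string; by convexity it is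
   at least [2 ^ (3k)] times its value at the average agreement [2k]. *)
Lemma index_deterministic (K Y : finType) (k : nat)
    (enc : {ffun K -> bool} -> Y) (dec : Y -> K -> bool) :
  #|K| = 3 * k ->
  \sum_x \sum_i (dec (enc x) i != x i) <= k * 2 ^ (3 * k) ->
  32 ^ k <= #|Y| * 27 ^ k.
Proof.
(* [exp2_tangent] will need [k < 3 * k], so [k = 0] is treated apart. *)
move=> cK; have [->|k0] := posnP k; first by
  move=> _; rewrite muln1; apply/card_gt0P; exists (enc [ffun=> false]).
move=> err.
pose agr y (x : {ffun K -> bool}) := \sum_i (dec y i == x i).
pose dis x := \sum_i (dec (enc x) i != x i).
have agrE x : agr (enc x) x = 3 * k - dis x /\ dis x <= 3 * k.
  have : agr (enc x) x + dis x = 3 * k.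
    rewrite -big_split /= -cK -sum1_card; apply: eq_bigr => i _.
    by case: (_ == _).
  lia.
have up : \sum_x 2 ^ agr (enc x) x <= #|Y| * 27 ^ k.
  have -> : 27 ^ k = 3 ^ #|K| by rewrite cK expnM.
  rewrite -sum_nat_const.
  under [leqRHS]eq_bigr => y _ do rewrite -(sum_exp2_agreement (dec y)).
  rewrite exchange_big /=; apply: leq_sum => x _.
  by rewrite (bigD1 (enc x)) //= leq_addr.
have cX : #|{: {ffun K -> bool}}| = 2 ^ (3 * k).
  by rewrite card_ffun card_bool cK.
(* Summing the secant bound over inputs is what convexity provides; since the total of [dis] is at
   most [k * 2 ^ (3 * k)], the terms in [k] will cancel. *)
have lo : 2 ^ (3 * k) * (2 ^ (3 * k - k) * (k + 2)) <=
    2 * (\sum_x 2 ^ agr (enc x) x) + 2 ^ (3 * k - k) * (\sum_x dis x).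
  rewrite -cX -sum_nat_const !big_distrr -big_split /=.
  apply: leq_sum => x _; have [-> le] := agrE x.
  by apply: exp2_tangent => //; lia.
have e32 : 32 ^ k = 2 ^ (3 * k) * 2 ^ (3 * k - k).
  rewrite -expnD -[32]/(2 ^ 5) -expnM; congr (_ ^ _); lia.
apply: leq_trans up; rewrite e32.
move: err lo; rewrite -/(dis _); set S := \sum_x dis x; set T := \sum_x _.
set a := 2 ^ (3 * k); set b := 2 ^ (3 * k - k) => err lo.
have : b * S <= b * (k * a) by rewrite leq_mul2l err orbT.
nia.
Qed.

End DeterministicIndex.

(** * Fixing the coins: averaging and measurability *)

(** First-moment method: the expected number of bad events is below [t], so some outcome has fewer
    than [t]. *)
Lemma exists_few_bad_events (R : realType) (d : measure_display)
    (Omega : measurableType d) (P : probability Omega R) (J : finType)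
    (B : J -> set Omega) (eps t : R) :
  (forall j, measurable (B j)) -> (forall j, (P (B j) <= eps%:E)%E) ->
  0 <= t -> #|J|%:R * eps < t -> exists w, \sum_j \1_(B j) w < t.
Proof.
move=> mB PB t0 lt_t; apply: contrapT => /forallNP H.
have int_eq : (\int[P]_w (\sum_(j : J) (\1_(B j) w)%:E) =
    \sum_(j : J) P (B j))%E.
  rewrite ge0_integral_sum //=.
  - by apply: eq_bigr => j _; rewrite integral_indic // setIT.
  - by move=> j; apply/measurable_EFinP; exact: measurable_indic.
have : (t%:E <= #|J|%:R%:E * eps%:E)%E.
  apply: (@le_trans _ _ (\sum_(j : J) P (B j))%E).
    have -> : t%:E = (\int[P]_w (cst t%:E w))%E.
      by rewrite integral_cst //= (probability_setT P) mule1.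
    rewrite -int_eq; apply: ge0_le_integral => //.
    - apply: emeasurable_sum => j.
      by apply/measurable_EFinP; exact: measurable_indic.
    - move=> w _; rewrite sumEFin lee_fin leNgt; exact/negP/H.
  apply: (@le_trans _ _ (\sum_(j : J) eps%:E)%E); first exact: lee_sum.
  by rewrite sumEFin sumr_const -EFinM mulr_natl.
by rewrite -EFinM lee_fin leNgt lt_t.
Qed.

(** As [g] takes finitely many values, the event splits into a finite union over them. This handles
    randomized steps applied to a random memory state. *)
Lemma measurable_apply_fin (d : measure_display) (Omega : measurableType d)
    (Z : finType) (g : Omega -> Z) (h : Omega -> Z -> Prop) :
  (forall z, measurable [set w | g w = z]) ->
  (forall z, measurable [set w | h w z]) ->
  measurable [set w | h w (g w)].
Proof.
move=> mg mh.
have -> : [set w | h w (g w)] =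
    \big[setU/set0]_(z : Z) ([set w | g w = z] `&` [set w | h w z]).
  apply/seteqP; split => w /=.
    by move=> hw; rewrite (bigD1 (g w)) //=; left.
  by rewrite -bigcup_seq => -[z _ [/= <-]].
by apply: bigsetU_measurable => z _; exact: measurableI.
Qed.

Lemma measurable_sa_process (n s : nat) (d : measure_display)
    (Omega : measurableType d) (A : streaming_algorithm n s Omega)
    (l : seq (edge n)) (t : nat) (g : Omega -> s.-tuple bool) :
  (forall y, measurable [set w | g w = y]) ->
  forall y, measurable [set w | sa_process A w t (g w) l = y].
Proof.
elim: l t g => //= e l IH t g mg y.
apply: (IH t.+1 (fun w => sa_update A w t (g w) e)) => z.
apply: (measurable_apply_fin (h := fun w x => sa_update A w t x e = z)) => // x.
exact: sa_update_measurable.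
Qed.

Lemma measurable_sa_run (n s : nat) (d : measure_display)
    (Omega : measurableType d) (A : streaming_algorithm n s Omega)
    (l : seq (edge n)) (Q : 'S_n -> Prop) :
  measurable [set w | Q (sa_run A w l)].
Proof.
apply: (measurable_apply_fin (h := fun=> Q)) => sigma; last first.
  have [q|q] := pselect (Q sigma).
    by rewrite (_ : [set _ | _] = setT) //; apply/seteqP; split.
  by rewrite (_ : [set _ | _] = set0) //; apply/seteqP; split.
apply: (measurable_apply_fin (h := fun w x => sa_output A w x = sigma)) => x.
  by apply: measurable_sa_process; exact: sa_init_measurable.
exact: sa_output_measurable.
Qed.

Lemma sa_process_cat (n s : nat) (d : measure_display)
    (Omega : measurableType d) (A : streaming_algorithm n s Omega) (w : Omega)
    (t : nat) (x : s.-tuple bool) (l1 l2 : seq (edge n)) :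
  sa_process A w t x (l1 ++ l2) =
  sa_process A w (t + size l1) (sa_process A w t x l1) l2.
Proof. by elim: l1 t x => [|e l IH] t x /=; rewrite ?addn0 // IH addSnnS. Qed.

(** * The graph encoding an INDEX instance *)

(* The vertex [f (b, p, i)] is [a_i^p] if [b = false] and [b_j^p] with [j = i] if
   [b = true]. *)
Section IndexGraph.
Variables (m n : nat) (f : bool * bool * 'I_m -> 'I_n).
Hypothesis f_inj : injective f.
Implicit Types (x : {ffun 'I_m * 'I_m -> bool}) (ij : 'I_m * 'I_m).

Definition alice_edge x ij : edge n :=
  (f (false, x ij, ij.1), f (true, x ij, ij.2)).

Definition bob_edge ij (p : bool) : edge n :=
  (f (true, p, ij.2), f (false, ~~ p, ij.1)).

Definition alice_stream x := [seq alice_edge x ij | ij <- enum {: 'I_m * 'I_m}].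

Definition bob_stream ij := [seq bob_edge ij p | p <- [:: false; true]].

Definition index_graph x ij : digraph n :=
  [set e in alice_stream x ++ bob_stream ij].

Definition decode_bit ij (sigma : 'S_n) : bool :=
  (sigma (f (true, false, ij.2)) < sigma (f (false, false, ij.1)))%N.

Lemma size_alice_stream x : size (alice_stream x) = (m * m)%N.
Proof. by rewrite size_map -cardE card_prod card_ord. Qed.

Lemma index_graph_stream x ij :
  stream_of (index_graph x ij) (alice_stream x ++ bob_stream ij).
Proof.
apply: uniq_perm; last 2 first.
- exact: enum_uniq.
- by move=> e; rewrite mem_enum inE.
(* A stream lists each edge once; Bob's edges are new because their tails lie on the [b] side. *)
rewrite cat_uniq; apply/and3P; split.
- rewrite map_inj_uniq ?enum_uniq // => -[i j] [i' j'].
  by case=> /f_inj[_ ->] /f_inj[_ ->].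
- apply/hasPn => e /mapP[p _ ->]; apply/negP => /mapP[q _ [/f_inj]].
  by [].
- by rewrite map_inj_uniq // => p q [/f_inj[]].
Qed.

Lemma mem_index_graph x ij e : e \in index_graph x ij ->
  (exists kl, e = alice_edge x kl) \/ (exists p, e = bob_edge ij p).
Proof.
by rewrite inE mem_cat => /orP[/mapP[q _ ->]|/mapP[q _ ->]]; [left|right];
  exists q.
Qed.

Lemma alice_mem x ij kl : alice_edge x kl \in index_graph x ij.
Proof. by rewrite inE mem_cat map_f // mem_enum. Qed.

Lemma bob_mem x ij p : bob_edge ij p \in index_graph x ij.
Proof. by rewrite inE mem_cat orbC map_f //; case: p. Qed.

Lemma index_graph_acyclic x ij : acyclic (index_graph x ij).
Proof.
(* With [p = x ij] and [q = ~~ p], the graph is layered as: other tails, head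
   [j] of copy [q], tail [i] of copy [p], head [j] of copy [p], tail [i] of
   copy [q], other heads. *)
pose r (v : bool * bool * 'I_m) : nat :=
  let: (b, p, k) := v in
  if b then if k == ij.2 then if p == x ij then 3 else 1 else 5
  else if k == ij.1 then if p == x ij then 2 else 4 else 0.
(* A left inverse of [f]; the default value only reaches vertices outside its image, which are
   isolated. *)
pose g u := odflt (false, false, ij.1) [pick v | f v == u].
have fK v : g (f v) = v.
  by rewrite /g; case: pickP => [u /eqP/f_inj//|/(_ v)]; rewrite eqxx.
apply: (@acyclic_of_rank _ _ (r \o g)) => u v /mem_index_graph.
case=> [[kl [-> ->]]|[p [-> ->]]] /=; rewrite !fK /= ?eqxx; last first.
  by case: p; case: (x ij).
case: ij @r @g fK => i j /= fK; case: kl => k l /=.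
case: (eqVneq k i) => [->|_]; case: (eqVneq l j) => [->|_] //=.
- by rewrite eqxx.
- by case: ifP.
- by case: ifP.
Qed.

(** If the bit is 0, Alice's edge goes from [a_i^0] to [b_j^0]; if it is 1, there is a path
    [b_j^0 -> a_i^1 -> b_j^1 -> a_i^0]. Injectivity of [sigma] makes the inequality strict. *)
Lemma decode_bitP x ij (sigma : 'S_n) :
  topological_ordering (index_graph x ij) sigma -> decode_bit ij sigma = x ij.
Proof.
move=> top.
have le u v : (u, v) \in index_graph x ij -> (sigma u <= sigma v)%N.
  by move=> uv; rewrite leqNgt; apply/negP => lt; apply: top; exists u, v.
have := le _ _ (alice_mem x ij ij); rewrite /decode_bit.
case: (x ij) => /= h; last by rewrite ltnNge h.
rewrite ltn_neqAle; apply/andP; split.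
  by apply/negP => /eqP/val_inj/perm_inj/f_inj.
apply: leq_trans (le _ _ (bob_mem x ij false)) _.
exact: leq_trans h (le _ _ (bob_mem x ij true)).
Qed.

End IndexGraph.

(** * The reduction and the final bound *)

(** The graph uses [4 * m] vertices; taking [m = 3 * q] makes a third of the [m ^ 2] bits the
    integer [3 * q ^ 2]. *)
Lemma topo_sort_index_bound (R : realType) (n s q : nat) (d : measure_display)
    (Omega : measurableType d) (P : probability Omega R)
    (A : streaming_algorithm n s Omega) :
  (12 * q <= n)%N -> solves_topo_sort P A (1 / 3) ->
  (32 ^ (3 * q ^ 2) <= 2 ^ s * 27 ^ (3 * q ^ 2))%N.
Proof.
move=> qn sol; pose m := (3 * q)%N; pose T := (bool * bool * 'I_m)%type.
have cT : (#|{: T}| <= n)%N.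
  by rewrite !card_prod card_bool card_ord /m; lia.
pose f (v : T) : 'I_n := widen_ord cT (enum_rank v).
have f_inj : injective f.
  by move=> u v /(congr1 val) /= /val_inj /enum_rank_inj.
pose K := ('I_m * 'I_m)%type; pose X := {ffun K -> bool}.
have cK : #|{: K}| = (3 * (3 * q ^ 2))%N by rewrite card_prod card_ord /m; lia.
have cX : #|{: X}| = (2 ^ (3 * (3 * q ^ 2)))%N.
  by rewrite card_ffun card_bool cK.
pose str (x : X) (ij : K) := alice_stream f x ++ bob_stream f ij.
pose B (j : X * K) := [set w | ~ topological_ordering
  (index_graph f j.1 j.2) (sa_run A w (str j.1 j.2))].
(* The expected number of failures is at most a third of all pairs; the successor turns this into a
   strict bound, undone below by integrality. *)
have [w] : exists w, \sum_j \1_(B j) w <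
    (3 * q ^ 2 * 2 ^ (3 * (3 * q ^ 2))).+1%:R :> R.
  apply: (@exists_few_bad_events _ _ _ P _ B (1 / 3)) => //.
  - move=> j; exact: (@measurable_sa_run _ _ _ _ _ _
      (fun sigma => ~ topological_ordering _ sigma)).
  - move=> j; apply: sol; first exact: index_graph_acyclic.
    exact: index_graph_stream.
  - rewrite card_prod cX cK; set M := (2 ^ _)%N; set k := (3 * q ^ 2)%N.
    have -> : (M * (3 * k))%:R * (1 / 3) = (k * M)%:R :> R.
      by rewrite !natrM; field.
    by rewrite ltr_nat.
rewrite (eq_bigr (fun j => (nat_of_bool (w \in B j))%:R)); last first.
  by move=> j _; rewrite indicE.
rewrite -natr_sum ltr_nat ltnS => few.
pose enc (x : X) := sa_process A w 0 (sa_init A w) (alice_stream f x).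
(* Bob resumes at time [m * m], the length of Alice's stream for every input, so he needs only the
   memory [y]. *)
pose dec y (ij : K) := decode_bit f ij
  (sa_output A w (sa_process A w (m * m) y (bob_stream f ij))).
have -> : (2 ^ s)%N = #|{: s.-tuple bool}| by rewrite card_tuple card_bool.
apply: (index_deterministic (enc := enc) (dec := dec) cK).
apply: leq_trans few; rewrite pair_bigA /=; apply: leq_sum => -[x ij] _ /=.
case: eqP => //= ne; rewrite lt0b; apply/mem_set => /= top; apply: ne.
have <- := decode_bitP f_inj top.
by rewrite /dec /enc /sa_run /str sa_process_cat size_alice_stream.
Qed.

Theorem theorem2p1 (R : realType) :
  exists c : R, 0 < c /\
  exists N : nat, forall n : nat, (N <= n)%N ->
  forall (s : nat) (d : measure_display) (Omega : measurableType d)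
    (P : probability Omega R) (A : streaming_algorithm n s Omega),
    solves_topo_sort P A (1 / 3) ->
    c * n%:R ^+ 2 <= s%:R.
Proof.
(* With [n <= 24 * q] and [3 * q ^ 2 <= 5 * s], [n ^ 2 <= 576 * q ^ 2 <= 192 * 5 * s = 960 * s]. The
   threshold 12 ensures [q >= 1], hence [n <= 24 * q]. *)
exists (1 / 960); split; first by lra.
exists 12 => n n12 s d Omega P A sol.
pose q := (n %/ 12)%N.
have qn : (12 * q <= n)%N by rewrite /q; lia.
have nq : (n <= 24 * q)%N by rewrite /q; lia.
have := topo_sort_index_bound qn sol; set k := (3 * q ^ 2)%N => bnd.
have ks : (k <= 5 * s)%N by exact: exponent_bound.
have : (n ^ 2 <= 960 * s)%N by move: ks; rewrite /k; nia.
by rewrite -(@ler_nat R) natrX natrM => h; lra.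
Qed.
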